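(* Let $T$ be a complete theory and suppose $\varphi(x,y)$ witnesses SOP$_1$ and there is no $n\in\omega$ such that $\bigwedge_{i=0}^n\varphi(x,y_i)$ witnesses SOP$_2$ (where $y_0,\dots,y_n$ are disjoint tuples of variables of the length of $y$). Then there exists $\langle b_\eta\rangle_{\eta\in{}^{\omega>}2}$ (in a monster model of $T$) such that $\langle\varphi(x,y),\langle b_\eta\rangle_{\eta\in{}^{\omega>}2}\rangle$ is an antichain tree.
   Context: ${}^{\omega>}2$ is the binary tree of finite $0/1$-sequences with initial-segment order $\trianglelefteq$. $\varphi(x,y)$ witnesses SOP$_1$ if there is $\langle a_\eta\rangle_{\eta\in{}^{\omega>}2}$ with $\{\varphi(x,a_{\eta\lceil n}):n<\omega\}$ consistent for each $\eta\in{}^\omega2$ and $\{\varphi(x,a_{\eta^\frown\langle1\rangle}),\varphi(x,a_{\eta^\frown\langle0\rangle^\frown\nu})\}$ inconsistent for all $\eta,\nu\in{}^{\omega>}2$. A formula $\psi(x,z)$ witnesses SOP$_2$ if there is $\langle c_\eta\rangle_{\eta\in{}^{\omega>}2}$ with $\{\psi(x,c_{\eta\lceil n}):n<\omega\}$ consistent for each $\eta\in{}^\omega2$ and $\{\psi(x,c_\eta),\psi(x,c_\nu)\}$ inconsistent for all $\trianglelefteq$-incomparable $\eta,\nu$. $\langle\varphi,\langle b_\eta\rangle\rangle$ is an antichain tree if for every $X\subseteq{}^{\omega>}2$, $\{\varphi(x,b_\eta):\eta\in X\}$ is consistent iff the elements of $X$ are pairwise $\trianglelefteq$-incomparable. 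*)

(* Defs.v *)
From mathcomp Require Import all_boot.
From Stdlib Require List.

Set Implicit Arguments.
Unset Strict Implicit.
Unset Printing Implicit Defensive.

Record signature := Signature {
  fsym : Type;  farity : fsym -> nat;
  rsym : Type;  rarity : rsym -> nat }.

Section Syntax.
Variable L : signature.

Inductive term : Type :=
  | tvar : nat -> term
  | tapp : forall f : fsym L, ('I_(farity f) -> term) -> term.

(* variables are named by natural numbers; [fall v p] binds variable v *)
Inductive formula : Type :=
  | ffalse : formula
  | feq : term -> term -> formula
  | frel : forall r : rsym L, ('I_(rarity r) -> term) -> formula
  | fimp : formula -> formula -> formula
  | fall : nat -> formula -> formula.

Fixpoint term_has_var (t : term) (v : nat) : Prop :=
  match t with
  | tvar i => i = v
  | tapp f args => exists i, term_has_var (args i) v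
  end.

Fixpoint free (p : formula) (v : nat) : Prop :=
  match p with
  | ffalse => False
  | feq t1 t2 => term_has_var t1 v \/ term_has_var t2 v
  | frel r args => exists i, term_has_var (args i) v
  | fimp p1 p2 => free p1 v \/ free p2 v
  | fall w p1 => v <> w /\ free p1 v
  end.
End Syntax.

Record structure (L : signature) := Structure {
  dom : Type;
  fint : forall f : fsym L, ('I_(farity f) -> dom) -> dom;
  rint : forall r : rsym L, ('I_(rarity r) -> dom) -> Prop }.

Section Semantics.
Variables (L : signature) (M : structure L).

Fixpoint teval (e : nat -> dom M) (t : term L) : dom M :=
  match t with
  | tvar i => e i
  | tapp f args => fint (fun i => teval e (args i))
  end.

Definition upd (e : nat -> dom M) (v : nat) (a : dom M) : nat -> dom M :=
  fun i => if i == v then a else e i.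

Fixpoint sat (e : nat -> dom M) (p : formula L) : Prop :=
  match p with
  | ffalse => False
  | feq t1 t2 => teval e t1 = teval e t2
  | frel r args => rint (fun i => teval e (args i))
  | fimp p1 p2 => sat e p1 -> sat e p2
  | fall v p1 => forall a : dom M, sat (upd e v a) p1
  end.

Definition env (k : nat) (a q : nat -> dom M) : nat -> dom M :=
  fun i => if i < k then a i else q i.

(* variables x (of length k) followed by y: x_i = var i, y_j = var (k+j) *)
Definition inst (p : formula L) (k : nat) (a b : nat -> dom M) : Prop :=
  sat (fun i => if i < k then a i else b (i - k)) p.

(** omega_1-saturation: every set of formulas in finitely many variables
    x_0..x_{k-1}, with parameters from a countable subset of M, which is
    finitely satisfiable in M, is realized in M. *)
Definition omega1_saturated : Prop :=
  forall (I : Type) (k : nat) (psi : I -> formula L) (par : I -> nat -> dom M)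
         (s : nat -> dom M),
    (forall j v, exists m, par j v = s m) ->
    (forall js : list I, exists a : nat -> dom M,
        forall j, List.In j js -> sat (env k a (par j)) (psi j)) ->
    exists a : nat -> dom M, forall j, sat (env k a (par j)) (psi j).
End Semantics.

(** * Trees and the combinatorial properties, for a (definable) relation
      R(x, y) between tuples (tuples are [nat -> M]; only the first
      |x| resp. |y| entries are relevant). *)

Section Tree.
Variable M : Type.
Variable R : (nat -> M) -> (nat -> M) -> Prop.

(* the binary tree ^{omega>}2 is seq bool, ordered by [prefix] *)
Definition incomparable (eta nu : seq bool) : Prop :=
  ~~ prefix eta nu /\ ~~ prefix nu eta.

(* {R(x, c_j) : j in X} is consistent (= finitely satisfiable in M) *)
Definition consistent (I : Type) (c : I -> nat -> M) (X : I -> Prop) : Prop :=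
  forall js : list I, (forall j, List.In j js -> X j) ->
    exists a : nat -> M, forall j, List.In j js -> R a (c j).

Definition branch (eta : nat -> bool) (n : nat) : seq bool := mkseq eta n.

Definition pair2 (I : Type) (u v : I) : I -> Prop := fun j => j = u \/ j = v.

Definition witnesses_SOP1 : Prop :=
  exists a : seq bool -> nat -> M,
    (forall eta : nat -> bool,
        consistent (fun n => a (branch eta n)) (fun _ => True)) /\
    (forall eta nu : seq bool,
        ~ consistent a (pair2 (rcons eta true) (eta ++ false :: nu))).

Definition witnesses_SOP2 : Prop :=
  exists c : seq bool -> nat -> M,
    (forall eta : nat -> bool,
        consistent (fun n => c (branch eta n)) (fun _ => True)) /\
    (forall eta nu : seq bool, incomparable eta nu -> ~ consistent c (pair2 eta nu)).

Definition antichain_tree (b : seq bool -> nat -> M) : Prop :=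
  forall X : seq bool -> Prop,
    consistent b X <->
    (forall eta nu, X eta -> X nu -> eta <> nu -> incomparable eta nu).
End Tree.

(* the conjunction /\_{i=0}^n R(x, y_i), where z = y_0 ^ ... ^ y_n and
   y_i is the i-th block of length l of z *)
Definition conj_rel (M : Type) (R : (nat -> M) -> (nat -> M) -> Prop)
  (l n : nat) : (nat -> M) -> (nat -> M) -> Prop :=
  fun x z => forall i, i <= n -> R x (fun j => z (i * l + j)).

(* Main.v *)
(** An idempotent ultrafilter U on the semigroup of words lets one draw trees of
nodes of the SOP_1 tree generically: [e ++ w] is a generic successor of [e] when
w is U-generic over everything drawn before, in depth-first order.  Idempotence
makes a generic successor of a generic successor again a generic successor, so
the consistency of a set of generic nodes depends only on its shape.

Let "level K" say that 2^K generic branches, one above each leaf of a generic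
binary tree of height K, are jointly consistent.  Level 0 is part of SOP_1.  If
level K holds and level K+1 fails on chains of length N, put the same binary
tree of chains of length N above each of the 2^K leaves: the blocks along a
branch are consistent by level K, while two incomparable blocks split every one
of the 2^K branches, so they contain a failure of level K+1.  This is SOP_2 for
a conjunction of N * 2^K instances.

If all levels hold, U is moreover chosen so that each of its members contains
some x 0^m 1 and x 0^m' 1 with m < m'.  Taking e x 0^m 1 as a node and building
its descendants above e x 0^m' 1 makes comparable nodes conflict by SOP_1, while
antichains are generic and hence consistent.  Saturation turns the finite
configurations so obtained into infinite ones. *)

Require Import Defs.
From mathcomp Require Import all_boot.
From mathcomp Require Import boolp classical_sets filter.

Set Implicit Arguments.
Unset Strict Implicit.
Unset Printing Implicit Defensive.

Local Open Scope classical_set_scope.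

(** * Idempotent ultrafilters *)

Section IdempotentUltrafilter.
Variables (S : Type) (op : S -> S -> S) (opA : associative op).
Implicit Types (F G p : set_system S) (A B : set S).

Definition filter_mul F G : set_system S :=
  fun A => F (fun x => G (fun y => A (op x y))).

(** A filter stands for the closed set of ultrafilters containing it; the inclusion makes that set
    closed under the product. *)
Definition subidempotent F := ProperFilter F /\ F `<=` filter_mul F F.

Lemma maximal_subidempotent F0 : subidempotent F0 ->
  exists F, [/\ subidempotent F, F0 `<=` F &
    forall G, subidempotent G -> F `<=` G -> G `<=` F].
Proof.
move=> F0P.
(* Zorn's lemma also ranges over the empty chain, so [F0] is joined to every union to keep a proper
   filter. *)
have [|A [AP Amax]] := @Zorn_bigcup (set S) (fun F => subidempotent (F0 `|` F)).
  move=> fam famP famtot; set H := F0 `|` _.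
  have common B1 B2 : H B1 -> H B2 ->
      exists Y, [/\ subidempotent Y, Y `<=` H, Y B1 & Y B2].
    have sub X : fam X -> F0 `|` X `<=` H.
      by move=> fX B [FB|XB]; [left|right; exists X].
    move=> [B1F|[X1 fX1 XB1]] [B2F|[X2 fX2 XB2]].
    - by exists F0; split=> // B; left.
    - by exists (F0 `|` X2); split; [exact: famP|exact: sub|left|right].
    - by exists (F0 `|` X1); split; [exact: famP|exact: sub|right|left].
    - have [X12|X21] := famtot _ _ fX1 fX2.
        by exists (F0 `|` X2); split;
          [exact: famP|exact: sub|right; exact: X12|right].
      by exists (F0 `|` X1); split;
        [exact: famP|exact: sub|right|right; exact: X21].
  split; last first.
    move=> B HB; have [Y [[Yp Yi] YH YB _]] := common _ _ HB HB.
    apply: (YH); move: (Yi _ YB); rewrite /filter_mul; apply: filterS => x; exact: YH.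
  split.
    move=> H0; have [Y [[Yp _] _ Y0 _]] := common _ _ H0 H0.
    exact: (@filter_not_empty _ Y).
  split.
  - by left; have [F0p _] := F0P; exact: filterT.
  - move=> B1 B2 HB1 HB2; have [Y [[Yp _] YH YB1 YB2]] := common _ _ HB1 HB2.
    by apply: YH; exact: filterI.
  - move=> B1 B2 B12 HB1; have [Y [[Yp _] YH YB1 _]] := common _ _ HB1 HB1.
    by apply: YH; exact: filterS YB1.
exists (F0 `|` A); split=> // G GP FG.
apply: contrapT => nGF; apply: (Amax G).
  rewrite properEneq; split; last by move=> B AB; apply: FG; right.
  by apply/eqP => AG; apply: nGF; rewrite -AG; exact: subsetUr.
rewrite (_ : F0 `|` G = G) //; apply/setUidPr => B FB.
by apply: FG; left.
Qed.

(** Ellis's argument, phrased with filters: maximality of [F] absorbs first [filter_mul F p], then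
    the filter describing the solutions [q] of [filter_mul q p = p], so [p] itself is a solution. *)
Lemma exists_idempotent_ultrafilter F0 : subidempotent F0 ->
  exists p, [/\ UltraFilter p, F0 `<=` p & filter_mul p p = p].
Proof.
move=> /maximal_subidempotent [F [[Fp Fi] F0F Fmax]].
have [p [pU Fsp]] := ultraFilterLemma Fp.
have FpF A : filter_mul F p A -> F A.
  apply: (Fmax (filter_mul F p)); last first.
    by move=> B /Fi; rewrite /filter_mul; apply: filterS => x; exact: Fsp.
  split.
    split.
      by rewrite /filter_mul => /filter_ex [x]; exact: filter_not_empty.
    split.
    - by rewrite /filter_mul; apply: filterE => x; exact: filterT.
    - rewrite /filter_mul => B1 B2 h1 h2; apply: filterS (filterI h1 h2) => x [] /= b1 b2.
      exact: filterI.
    - rewrite /filter_mul => B1 B2 B12; apply: filterS => x; apply: filterS => y; exact: B12.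
  rewrite /filter_mul => B /Fi; rewrite /filter_mul; apply: filterS => s /Fi sB.
  apply: Fsp; move: sB; rewrite /filter_mul; apply: filterS => t; apply: filterS => u.
  by apply: filterS => v; rewrite !opA.
(* An ultrafilter [q] contains [div A] for all [A] in [p] exactly when [p] is included in
   [filter_mul q p]. *)
pose div A : set S := fun x => p (fun y => A (op x y)).
pose H : set_system S := fun B => exists C A, [/\ F C, p A & C `&` div A `<=` B].
have HF : H `<=` F.
  apply: (Fmax H); last first.
    by move=> C FC; exists C, setT; split; [exact: FC|exact: filterT|exact: subIsetl].
  have HI : setI_closed H.
    move=> B1 B2 [C1 [A1 [FC1 pA1 s1]]] [C2 [A2 [FC2 pA2 s2]]].
    exists (C1 `&` C2), (A1 `&` A2); split; [exact: filterI|exact: filterI|].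
    move=> x [[c1 c2] dA]; split; [apply: s1|apply: s2]; split => //;
      by apply: filterS dA => y [].
  have HS B1 B2 : B1 `<=` B2 -> H B1 -> H B2.
    by move=> B12 [C [A [FC pA s]]]; exists C, A; split=> //; exact: subset_trans B12.
  have HFs C : F C -> H C.
    by move=> FC; exists C, setT; split; [exact: FC|exact: filterT|exact: subIsetl].
  have Hdiv A : p A -> H (div A).
    by move=> pA; exists setT, A; split; [exact: filterT|exact: pA|exact: subIsetr].
  split.
    split; last by split; [apply: HFs; exact: filterT|exact: HI|exact: HS].
    (* Properness: if [C] misses [div A], each [x] in [C] translates the complement of [A] into [p],
       so [FpF] puts this complement into [F], against [A] in [p]. *)
    move=> [C [A [FC pA CA0]]].
    suff /Fsp pnA : F (~` A).
      by have /filter_ex [x []] : p (A `&` ~` A) by exact: filterI.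
    apply: FpF; rewrite /filter_mul; apply: filterS FC => x Cx.
    have [pxA|//] := in_ultra_setVsetC (fun y => A (op x y)) pU.
    by case: (CA0 x).
  move=> B [C [A [FC pA sB]]].
  apply: (HS _ _ _ (HI _ _ (HFs _ (Fi _ FC)) (Hdiv _ pA))) => x [Cx Ax].
  apply: (HS _ _ _ (HI _ _ (HFs _ Cx) (Hdiv _ Ax))) => y [Cxy Axy].
  by apply: sB; split=> //; apply: filterS Axy => z; rewrite opA.
have pp A : p A -> filter_mul p p A.
  move=> pA; apply: Fsp; apply: HF; exists setT, A.
  by split; [exact: filterT|exact: pA|exact: subIsetr].
have pI : setI_closed p by move=> A B; exact: filterI.
exists p; split=> // [B /F0F /Fsp //|].
apply/seteqP; split=> // A pA.
have [//|/pp] := in_ultra_setVsetC A pU.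
move: pA; rewrite /filter_mul => pA pnA.
have /filter_ex [x [pxA pxnA]] := pI _ _ pA pnA.
by have /filter_ex [y []] := pI _ _ pxA pxnA.
Qed.

End IdempotentUltrafilter.

Local Notation word := (seq bool).

Definition comb (x : word) (m : nat) : word := x ++ rcons (nseq m false) true.

(** The filter [F0] of sets containing almost all combs over each [x] is subidempotent, since a comb
    preceded by any word is again a comb. A set with at most one comb over each [x] has its
    complement in [F0], so it is not in [U]. *)
Lemma exists_comb_ultrafilter : exists U : set_system word,
  [/\ UltraFilter U, filter_mul cat U U = U &
    forall A, U A -> exists x m m',
      [/\ m < m', A (comb x m) & A (comb x m')]].
Proof.
pose F0 : set_system word :=
  fun A => forall x, exists n, forall m, n <= m -> A (comb x m).
have F0f : Filter F0.
  split.
  - by move=> x; exists 0.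
  - move=> A B FA FB x; have [n hn] := FA x; have [n' hn'] := FB x.
    exists (maxn n n') => m; rewrite geq_max => /andP[/hn ? /hn' ?]; by split.
  - by move=> A B AB FA x; have [n hn] := FA x; exists n => m /hn /AB.
have F0i : subidempotent cat F0.
  split; first by split=> // /(_ [::]) [n] /(_ n (leqnn n)).
  move=> A FA x; exists 0 => m _ y; have [n hn] := FA (comb x m ++ y).
  by exists n => m' /hn; rewrite /comb -!catA.
have [U [UU F0U Ui]] := exists_idempotent_ultrafilter (@catA _) F0i.
exists U; split=> // A UA; apply: contrapT => nA.
have /F0U UnA : F0 (~` A).
  move=> x; apply: contrapT => nx; apply: nA.
  have inf n : exists2 m, n <= m & A (comb x m).
    apply: contrapT => hn; apply: nx; exists n => m nm Am.
    by apply: hn; exists m.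
  have [m _ Am] := inf 0; have [m' mm' Am'] := inf m.+1.
  by exists x, m, m'.
by have /filter_ex [x []] : U (A `&` ~` A) by exact: filterI.
Qed.

(** * Generic trees *)

Definition prime_filter (T : Type) (F : set_system T) :=
  ProperFilter F /\ forall A, F A \/ F (~` A).

Section GenericTrees.
Variables (U : set_system word) (UU : UltraFilter U).
Hypothesis (U_idem : filter_mul cat U U = U).

(* A generic tree above [e], with its nodes drawn in depth-first order from U,
   is encoded by the filter of the properties of the resulting node list. *)
Definition draws (X : Type) := word -> set_system (seq X).

Section Operations.
Variable X : Type.
Implicit Types (f : word -> seq X) (g : draws X) (e : word) (k : set (seq X)).

Definition stop : draws X := fun e k => k [::].
Definition draw f g : draws X :=
  fun e k => U (fun w => g (e ++ w) (fun l => k (f (e ++ w) ++ l))).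
(** Both subtrees start at [e], but the second one is drawn generically over the whole first one. *)
Definition fork g1 g2 : draws X :=
  fun e k => g1 e (fun l1 => g2 e (fun l2 => k (l1 ++ l2))).
Definition skip := draw (fun _ => [::]).
Definition split_at g := skip (fork g g).

Lemma prime_stop e : prime_filter (stop e).
Proof.
rewrite /stop; split; last by move=> A; exact: EM.
by split=> [[]|]; split=> // A B AB; exact: AB.
Qed.

Lemma prime_draw f g : (forall e, prime_filter (g e)) ->
  forall e, prime_filter (draw f g e).
Proof.
move=> gP e; rewrite /draw; split.
  split.
    move=> /filter_ex [w]; case: (gP (e ++ w)) => gp _; exact: filter_not_empty.
  split.
  - by apply: filterE => w; case: (gP (e ++ w)) => gp _; exact: filterT.
  - move=> A B UA UB; apply: filterS2 UA UB => w.
    case: (gP (e ++ w)) => gp _; exact: filterI.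
  - move=> A B AB; apply: filterS => w.
    case: (gP (e ++ w)) => gp _; apply: filterS => l; exact: AB.
move=> A.
have [|nA] := in_ultra_setVsetC
  (fun w => g (e ++ w) (fun l => A (f (e ++ w) ++ l))) UU; first by left.
right; apply: filterS nA => w.
by case: (gP (e ++ w)) => gp /(_ (fun l => A (f (e ++ w) ++ l))) [].
Qed.

Lemma prime_fork g1 g2 :
  (forall e, prime_filter (g1 e)) -> (forall e, prime_filter (g2 e)) ->
  forall e, prime_filter (fork g1 g2 e).
Proof.
move=> g1P g2P e; rewrite /fork.
case: (g1P e) => g1p g1u; case: (g2P e) => g2p g2u; split.
  split.
    move=> /filter_ex [l]; exact: filter_not_empty.
  split.
  - by apply: filterE => l; exact: filterT.
  - move=> A B UA UB; apply: filterS2 UA UB => l; exact: filterI.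
  - move=> A B AB; apply: filterS => l; apply: filterS => l'; exact: AB.
move=> A.
have [|nA] := g1u (fun l => g2 e (fun l' => A (l ++ l'))); first by left.
right; apply: filterS nA => l nl.
by case: (g2u (fun l' => A (l ++ l'))).
Qed.

(** Idempotence enters here: an unrecorded draw followed by a draw amounts to one draw. This is how
    unselected nodes disappear from all patterns below. *)
Lemma skip_draw f g : skip (draw f g) = draw f g.
Proof.
apply: funext => e; apply: funext => k; rewrite /skip /draw -[in RHS]U_idem.
by rewrite /filter_mul; congr U; apply: funext => w; congr U;
  apply: funext => w'; rewrite /= catA.
Qed.

Lemma skip_stop : skip stop = stop.
Proof.
apply: funext => e; apply: funext => k; rewrite /skip /draw /stop /=.
apply: propext; split=> [/filter_ex [] //|kP].
by apply: filterE.
Qed.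

Lemma stop_fork g : fork stop g = g.
Proof. by []. Qed.

Lemma fork_stop g : fork g stop = g.
Proof.
apply: funext => e; apply: funext => k; rewrite /fork /stop.
by congr (g e); apply: funext => l; rewrite cats0.
Qed.

Lemma iter_skip_draw n f g : iter n skip (draw f g) = draw f g.
Proof. by elim: n => //= n ->; rewrite skip_draw. Qed.

Lemma iter_skip n g : 0 < n -> iter n skip g = skip g.
Proof. by case: n => // n _; rewrite iterSr iter_skip_draw. Qed.

Lemma iter_skip_stop n : iter n skip stop = stop.
Proof. by elim: n => //= n ->; rewrite skip_stop. Qed.

End Operations.

Definition keep := draw (fun w => [:: w]).
Definition chain n : draws word := iter n keep (@stop word).

Lemma prime_chain n e : prime_filter (chain n e).
Proof.
by elim: n e => [|n IH] e; [exact: prime_stop|exact: prime_draw].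
Qed.

Lemma prime_levels K (g : draws word) : (forall e, prime_filter (g e)) ->
  forall e, prime_filter (iter K (@split_at word) g e).
Proof.
move=> gP; elim: K => [|K IH] // e.
by apply: prime_draw; apply: prime_fork.
Qed.

Lemma iter_skip_chain m n : 0 < n -> iter m (@skip word) (chain n) = chain n.
Proof. by case: n => // n _; exact: iter_skip_draw. Qed.

Lemma chain_prefix n e :
  chain n e (fun l => exists2 u, prefix e u & forall w, w \in l -> prefix w u).
Proof.
elim: n e => [|n IH] e; first by exists e; rewrite ?prefix_refl.
rewrite /chain /= /keep /draw; apply: filterE => w.
have [cP _] := prime_chain n (e ++ w).
apply: filterS (IH (e ++ w)) => l [u ewu lu]; exists u => [|v].
  by apply: prefix_trans ewu; exact: prefix_prefix.
by rewrite inE => /orP[/eqP ->|/lu].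
Qed.

Lemma chain_size n e : chain n e (fun l => size l = n).
Proof.
elim: n e => [|n IH] e //; rewrite /chain /= /keep /draw; apply: filterE => w.
have [cP _] := prime_chain n (e ++ w).
by apply: filterS (IH (e ++ w)) => l /= ->.
Qed.

Lemma levels_size n K e :
  iter K (@split_at word) (chain n) e (fun l => size l = n * 2 ^ K).
Proof.
elim: K e => [|K IH] e /=.
  have [cP _] := prime_chain n e.
  by apply: filterS (chain_size n e) => l ->; rewrite muln1.
rewrite /split_at /skip /draw /fork; apply: filterE => w /=.
have [gP _] := prime_levels K (prime_chain n) (e ++ w).
apply: filterS (IH (e ++ w)) => l1 h1; apply: filterS (IH (e ++ w)) => l2 h2.
by rewrite size_cat h1 h2 expnS mul2n -addnn mulnDr.
Qed.

(** * Labelled trees of draws and selection by label *)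

Inductive ltree (T : Type) :=
  | Lstop | Ldraw of T & ltree T | Lfork of ltree T & ltree T.
Arguments Lstop {T}.

Fixpoint run (T X : Type) (f : T -> word -> seq X) (t : ltree T) : draws X :=
  match t with
  | Lstop => @stop X
  | Ldraw a t => draw (f a) (run f t)
  | Lfork t1 t2 => fork (run f t1) (run f t2)
  end.

Definition pick_label (T : Type) (P : pred T) (a : T) (w : word) : seq word :=
  if P a then [:: w] else [::].

Lemma prime_run (T X : Type) (f : T -> word -> seq X) t e :
  prime_filter (run f t e).
Proof.
elim: t e => [|a t IH|t1 IH1 t2 IH2] e /=.
- exact: prime_stop.
- exact: prime_draw.
- exact: prime_fork.
Qed.

(** Several selections can thus be made from one and the same labelled run, each behaving like a run
    of its own in which the other nodes are skipped. *)
Lemma run_pick_label (T : Type) (P : pred T) t e k :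
  run (pick_label P) t e k =
  run (fun a w => [:: (a, w)]) t e (fun l => k [seq x.2 | x <- l & P x.1]).
Proof.
elim: t e k => [|a t IH|t1 IH1 t2 IH2] e k //=.
  rewrite /draw; congr U; apply: funext => w; rewrite IH; congr (run _ _ _).
  by apply: funext => l /=; rewrite /pick_label; case: (P a).
rewrite /fork IH1; congr (run _ _ _); apply: funext => l1.
rewrite IH2; congr (run _ _ _); apply: funext => l2.
by rewrite filter_cat map_cat.
Qed.

(** * Binary trees of blocks of [N] draws *)

Section BlockTree.
Variable N : nat.
Hypothesis N_gt0 : 0 < N.

(* Only nodes labelled [Some _] are ever picked. *)
Fixpoint block_tree J (tau : word) : ltree (option word) :=
  if J is J'.+1 then
    iter N (Ldraw (Some tau)) (Lfork (block_tree J' (rcons tau false))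
                                     (block_tree J' (rcons tau true)))
  else Lstop.

Definition split_levels K (t : ltree (option word)) : ltree (option word) :=
  iter K (fun t => Ldraw None (Lfork t t)) t.

Definition run_labels (P : pred word) := run (pick_label (oapp P false)).

Lemma run_split_levels P K t :
  run_labels P (split_levels K t) = iter K (@split_at word) (run_labels P t).
Proof. by elim: K => //= K IH; rewrite /run_labels /= -/(run_labels _) IH. Qed.

Lemma run_iter_draw P n tau t :
  run_labels P (iter n (Ldraw (Some tau)) t) =
  iter n (if P tau then keep else @skip word) (run_labels P t).
Proof.
elim: n => [|n IH] //=.
rewrite -IH {1}/run_labels /= -/(run_labels _) /pick_label /=.
by case: (P tau).
Qed.

Lemma run_block_treeS P J tau :
  run_labels P (block_tree J.+1 tau) =
  iter N (if P tau then keep else @skip word)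
    (fork (run_labels P (block_tree J (rcons tau false)))
          (run_labels P (block_tree J (rcons tau true)))).
Proof. exact: run_iter_draw. Qed.

Lemma run_block_tree0 P J tau : (forall v, ~~ P (tau ++ v)) ->
  run_labels P (block_tree J tau) = @stop word.
Proof.
elim: J tau => [|J IH] tau nP //.
rewrite run_block_treeS !IH; try by move=> v; rewrite cat_rcons.
move: (nP [::]); rewrite cats0 => /negbTE ->.
exact: iter_skip_stop.
Qed.

(** Blocks below [u] are skipped and absorbed by the first draw of block [u], which exists as
    [0 < N]; all other subtrees yield nothing. *)
Lemma run_block_tree1 P J tau u : size u < J ->
  (forall v, P (tau ++ v) = (v == u)) ->
  run_labels P (block_tree J tau) = chain N.
Proof.
elim: J tau u => [|J IH] tau u // uJ Pu.
rewrite run_block_treeS; move: (Pu [::]); rewrite cats0 => ->.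
case: u => [|b u] in uJ Pu *.
  have P0 b : run_labels P (block_tree J (rcons tau b)) = @stop word.
    by apply: run_block_tree0 => v; rewrite cat_rcons Pu.
  by rewrite !P0.
have side : run_labels P (block_tree J (rcons tau b)) = chain N.
  by apply: (IH _ u) => // v; rewrite cat_rcons Pu eqseq_cons eqxx.
have other : run_labels P (block_tree J (rcons tau (~~ b))) = @stop word.
  by apply: run_block_tree0 => v; rewrite cat_rcons Pu eqseq_cons; case: (b).
rewrite [LHS](_ : _ = iter N (@skip word) (chain N)).
  exact: iter_skip_chain.
by case: b side other {uJ Pu} => /= -> ->; rewrite ?fork_stop ?stop_fork.
Qed.

(** The skipped block at the meet of [u1] and [u2] collapses to the single skip of [split_at], and
    this skip absorbs the blocks below it. Each side then contributes one chain. *)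
Lemma run_block_tree2 P J tau u1 u2 : size u1 < J -> size u2 < J ->
  incomparable u1 u2 ->
  (forall v, P (tau ++ v) = (v == u1) || (v == u2)) ->
  run_labels P (block_tree J tau) = split_at (chain N).
Proof.
elim: J tau u1 u2 => [|J IH] tau u1 u2 // u1J u2J [u12 u21] Pu.
rewrite run_block_treeS; move: (Pu [::]); rewrite cats0 => ->.
case: u1 => [|b u1] in u1J u12 u21 Pu *; first by rewrite prefix0s in u12.
case: u2 => [|c u2] in u2J u12 u21 Pu *; first by rewrite prefix0s in u21.
rewrite !prefix_cons /= in u12 u21 *.
have [bc|bc] := eqVneq b c; last first.
  have side d : run_labels P (block_tree J (rcons tau d)) = chain N.
    have [db|db] := eqVneq d b.
      apply: (@run_block_tree1 _ _ _ u1) => // v; rewrite cat_rcons Pu.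
      by rewrite !eqseq_cons db eqxx (negbTE bc) orbF.
    have dc : d = c by case: (d) (b) (c) db bc => [] [] [].
    apply: (@run_block_tree1 _ _ _ u2) => // v; rewrite cat_rcons Pu.
    by rewrite !eqseq_cons dc eqxx (eq_sym c) (negbTE bc).
  by rewrite !side iter_skip.
rewrite -bc eqxx /= in u12 u21.
have side : run_labels P (block_tree J (rcons tau b)) = split_at (chain N).
  apply: (IH _ u1 u2) => // v.
  by rewrite cat_rcons Pu -bc !eqseq_cons eqxx.
have other : run_labels P (block_tree J (rcons tau (~~ b))) = @stop word.
  apply: run_block_tree0 => v; rewrite cat_rcons Pu -bc !eqseq_cons.
  by case: (b).
rewrite [LHS](_ : _ = iter N (@skip word) (split_at (chain N))).
  exact: iter_skip_draw.
by case: b side other {u1J Pu bc} => /= -> ->; rewrite ?fork_stop ?stop_fork.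
Qed.

Lemma run_block_tree_branch P J tau u : size u = J ->
  (forall v, P (tau ++ v) = prefix v u) ->
  run_labels P (block_tree J tau) = chain (J * N).
Proof.
elim: J tau u => [|J IH] tau u // uJ Pu.
rewrite run_block_treeS; move: (Pu [::]); rewrite cats0 prefix0s => ->.
case: u uJ Pu => [|b u] // [uJ] Pu.
have side : run_labels P (block_tree J (rcons tau b)) = chain (J * N).
  by apply: (IH _ u) => // v; rewrite cat_rcons Pu prefix_cons eqxx.
have other : run_labels P (block_tree J (rcons tau (~~ b))) = @stop word.
  by apply: run_block_tree0 => v; rewrite cat_rcons Pu prefix_cons; case: (b).
rewrite /chain mulSn iterD -/(chain _) -side; congr (iter N keep _).
by case: b side other {Pu} => /= _ ->; rewrite ?fork_stop ?stop_fork.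
Qed.

End BlockTree.

Lemma filter_all_words (T : Type) (F : set_system T) (FF : Filter F) J
    (k : word -> set T) :
  (forall u, size u <= J -> F (k u)) ->
  F (fun x => forall u, size u <= J -> k u x).
Proof.
elim: J k => [|J IH] k Fk.
  by apply: filterS (Fk [::] isT) => x kx [].
have Fb b : F (fun x => forall u, size u <= J -> k (b :: u) x).
  by apply: IH => u uJ; exact: Fk.
apply: filterS3 (Fk [::] isT) (Fb true) (Fb false) => x k0 k1 k2.
by case=> [|[] u] // uJ; [exact: k1|exact: k2].
Qed.

(* A [cut] encodes a maximal antichain of a finite binary tree. *)
Inductive cut := Cleaf | Csplit of cut & cut.

Fixpoint cut_height A :=
  if A is Csplit A0 A1 then (maxn (cut_height A0) (cut_height A1)).+1 else 0.

Fixpoint cut_nodes A : seq word :=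
  if A is Csplit A0 A1 then
    map (cons false) (cut_nodes A0) ++ map (cons true) (cut_nodes A1)
  else [:: [::]].

Fixpoint run_cut A : draws word :=
  if A is Csplit A0 A1 then skip (fork (run_cut A0) (run_cut A1)) else chain 1.

Lemma prime_run_cut A e : prime_filter (run_cut A e).
Proof.
elim: A e => [|A0 IH0 A1 IH1] e; first exact: prime_chain.
by apply: prime_draw; apply: prime_fork.
Qed.

Lemma cut_height_split A0 A1 K :
  cut_height (Csplit A0 A1) <= K.+1 ->
  cut_height A0 <= K /\ cut_height A1 <= K.
Proof. by rewrite /= ltnS geq_max => /andP. Qed.

(** If the root is in [X], it is the only element; otherwise [X] splits according to the first
    letter. *)
Lemma antichain_sub_cut K (X : word -> Prop) :
  (forall u, X u -> size u <= K) ->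
  (forall u v, X u -> X v -> u <> v -> incomparable u v) ->
  exists2 A, cut_height A <= K & forall u, X u -> u \in cut_nodes A.
Proof.
elim: K X => [|K IH] X XK Xinc.
  by exists Cleaf => // u /XK; rewrite leqn0 size_eq0 inE.
have [X0|X0] := EM (X [::]).
  exists Cleaf => // u Xu; rewrite inE; have [//|/eqP u0] := eqVneq u [::].
  have [] := Xinc _ _ X0 Xu (fun h => u0 (esym h)); by rewrite prefix0s.
have side b : exists2 A, cut_height A <= K &
    forall u, X (b :: u) -> u \in cut_nodes A.
  apply: IH => [u /XK //|u v Xu Xv uv].
  have [|] := Xinc _ _ Xu Xv; first by case.
  by rewrite /incomparable !prefix_cons eqxx.
have [A0 A0K XA0] := side false; have [A1 A1K XA1] := side true.
exists (Csplit A0 A1); first by rewrite /= ltnS geq_max A0K.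
case=> [|[] u] Xu //=; rewrite mem_cat.
- by rewrite (map_f (cons true) (XA1 _ Xu)) orbT.
- by rewrite (map_f (cons false) (XA0 _ Xu)).
Qed.

Lemma filter_all_cuts (T : Type) (F : set_system T) (FF : Filter F) K
    (k : cut -> set T) :
  (forall A, cut_height A <= K -> F (k A)) ->
  F (fun x => forall A, cut_height A <= K -> k A x).
Proof.
elim: K k => [|K IH] k Fk.
  by apply: filterS (Fk Cleaf isT) => x kx [].
have Fs : F (fun x => forall A0, cut_height A0 <= K -> forall A1,
    cut_height A1 <= K -> k (Csplit A0 A1) x).
  apply: (IH) => A0 hA0; apply: IH => A1 hA1; apply: Fk.
  by rewrite /= ltnS geq_max hA0.
apply: filterS2 (Fk Cleaf isT) Fs => x k0 ks [|A0 A1] //.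
by move=> /cut_height_split [h0 h1]; exact: ks.
Qed.

(** Above each leaf of the cut one of the nodes of the full level is kept. The surplus nodes are
    dropped by [kS], the surplus draws are absorbed by idempotence. *)
Lemma run_cut_levels K A e (k : set (seq word)) : cut_height A <= K ->
  (forall s s', {subset s <= s'} -> k s' -> k s) ->
  iter K (@split_at word) (chain 1) e k -> run_cut A e k.
Proof.
elim: K A e k => [|K IH] A e k; first by case: A.
move=> AK kS; rewrite /= /split_at /skip /draw /fork.
have gP e' : ProperFilter (iter K (@split_at word) (chain 1) e').
  by case: (prime_levels K (prime_chain 1) e').
case: A AK => [_|A0 A1 /cut_height_split [A0K A1K]] gk.
  (* A leaf reached early is delayed by a skip, so that both sides consume the same draw. *)
  rewrite -[run_cut Cleaf](iter_skip_chain 1 (n := 1)) // /iter.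
  rewrite /skip /draw; apply: filterS gk => w gk.
  apply: (IH Cleaf) => //; apply: filterS gk => l1 /filter_ex [l2].
  by apply: kS => x /= xl; rewrite mem_cat xl.
rewrite /= /skip /draw /fork; apply: filterS gk => w gk.
have step s s' : {subset s <= s'} ->
    iter K (@split_at word) (chain 1) (e ++ w) (fun l2 => k (s' ++ l2)) ->
    iter K (@split_at word) (chain 1) (e ++ w) (fun l2 => k (s ++ l2)).
  move=> ss'; apply: filterS => l2; apply: kS => x; rewrite !mem_cat.
  by case/orP => [/ss' ->|->]; rewrite ?orbT.
have [rP _] := prime_run_cut A0 (e ++ w).
apply: filterS (IH _ _ _ A0K step gk) => l1 gk1.
apply: (IH _ _ _ A1K _ gk1) => s s' ss'; apply: kS => x; rewrite !mem_cat.
by case/orP => [->|/ss' ->]; rewrite ?orbT.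
Qed.

Section AntichainTree.
Hypothesis U_comb : forall A, U A -> exists x m m',
  [/\ m < m', A (comb x m) & A (comb x m')].

Definition sop1_conflict (u v : word) :=
  exists eta nu, u = rcons eta true /\ v = eta ++ false :: nu.

Lemma comb_conflict e x m m' v : m < m' ->
  sop1_conflict (e ++ comb x m) (e ++ comb x m' ++ v).
Proof.
(* The words part after [e x 0^m]: the first goes on with [true], the second with one more
   [false]. *)
move=> mm'; exists (e ++ x ++ nseq m false).
exists (rcons (nseq (m' - m.+1) false) true ++ v).
rewrite /comb -!rcons_cat !catA; split=> //.
have -> : m' = m + (m' - m.+1).+1 by rewrite addnS -addSn subnKC.
rewrite nseqD /= addnS subSS addKn.
by rewrite -!catA /= -!cats1 -!catA.
Qed.

(* In [run_cut] a node and its descendants are never picked together, so both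
   [h [::]] and the base of the two subtrees may be taken generic, from a
   single comb on which they conflict. *)
Lemma generic_antichain_tree K e (k : cut -> set (seq word)) :
  (forall A, cut_height A <= K -> run_cut A e (k A)) ->
  exists h : word -> word,
    [/\ forall u, size u <= K -> prefix e (h u),
        forall u v, size u <= K -> size v <= K -> prefix u v -> u <> v ->
          sop1_conflict (h u) (h v) &
        forall A, cut_height A <= K -> k A (map h (cut_nodes A))].
Proof.
elim: K e k => [|K IH] e k kP.
  have /filter_ex [w kw] : U (fun w => k Cleaf [:: e ++ w]) := kP Cleaf isT.
  exists (fun _ => e ++ w); split=> [u _|u v|[]] //.
    exact: prefix_prefix.
  by rewrite !leqn0 !size_eq0 => /eqP -> /eqP ->.
(* A good word can serve both as the root picked alone and as the base of the two subtrees. Both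
   roles are generic, so a comb supplies two good words, one for each role. *)
pose good w := k Cleaf [:: e ++ w] /\ forall A0, cut_height A0 <= K ->
  forall A1, cut_height A1 <= K -> run_cut A0 (e ++ w) (fun l0 =>
    run_cut A1 (e ++ w) (fun l1 => k (Csplit A0 A1) (l0 ++ l1))).
have /U_comb [x [m [m' [mm' [kx _] [_ good']]]]] : U good.
  apply: filterI; first exact: (kP Cleaf).
  apply: filter_all_cuts => A0 hA0; apply: filter_all_cuts => A1 hA1.
  by apply: (kP (Csplit A0 A1)); rewrite /= ltnS geq_max hA0.
set r := e ++ comb x m' in good'.
(* The first subtree is fixed while the second is still generic over it; the second is then built
   against the fixed first one. *)
have [|h0 [h0e h0c h0k]] := IH r (fun A0 l0 => forall A1, cut_height A1 <= K ->
    run_cut A1 r (fun l1 => k (Csplit A0 A1) (l0 ++ l1))).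
  move=> A0 hA0; have [rP _] := prime_run_cut A0 r.
  by apply: filter_all_cuts => A1 hA1; exact: good'.
have [|h1 [h1e h1c h1k]] := IH r (fun A1 l1 => forall A0, cut_height A0 <= K ->
    k (Csplit A0 A1) (map h0 (cut_nodes A0) ++ l1)).
  move=> A1 hA1; have [rP _] := prime_run_cut A1 r.
  by apply: filter_all_cuts => A0 hA0; exact: h0k.
pose h u := match u with
  | [::] => e ++ comb x m | false :: u' => h0 u' | true :: u' => h1 u' end.
have hr b u : size u <= K -> prefix r (h (b :: u)).
  by case: b => /=; [exact: h1e|exact: h0e].
exists h; split.
- case=> [|b u] uK; first exact: prefix_prefix.
  by apply: prefix_trans (hr b u uK); exact: prefix_prefix.
- case=> [|b u] [|c v] uK vK //.
    move=> _ _; have /prefixP [w ->] := hr c v vK.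
    by rewrite /r -catA; exact: comb_conflict.
  rewrite prefix_cons => /andP[/eqP <- uv] bu.
  have nuv : u <> v by move=> h'; apply: bu; rewrite h'.
  by case: (b) => /=; [exact: h1c|exact: h0c].
- case=> [|A0 A1] //= /cut_height_split [hA0 hA1].
  by rewrite map_cat -!map_comp; exact: h1k.
Qed.

End AntichainTree.

(** * Failing levels give finite SOP_2 trees, good levels give finite antichain trees *)

Section Consistency.
Variable C : set (seq word).
Hypothesis C_sub : forall s s', {subset s <= s'} -> C s' -> C s.
Hypothesis C_branch : forall u s, (forall w, w \in s -> prefix w u) -> C s.

(** All chain lengths are required, because a branch through [J] blocks of length [N] runs through a
    chain of length [J * N]. *)
Definition good_level K :=
  forall N, iter K (@split_at word) (chain N) [::] C.

Lemma good_level0 : good_level 0.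
Proof.
move=> N /=; have [cP _] := prime_chain N [::].
by apply: filterS (chain_prefix N [::]) => l [u _]; exact: C_branch.
Qed.

(** An approximation of height [J] to SOP_2 for a conjunction of [n] instances: words shorter than
    [J] are nodes, words of length [J] are branches. *)
Definition finite_SOP2 n J := exists c : word -> seq word,
  [/\ forall u, size u < J -> size (c u) = n,
      forall u s, size u = J ->
        (forall w, w \in s -> exists2 v, prefix v u & w \in c v) -> C s &
      forall u1 u2, size u1 < J -> size u2 < J -> incomparable u1 u2 ->
        ~ C (c u1 ++ c u2)].

(** The block size, branch consistency and incomparability clauses are each generic for a single
    labelled run ([R1], [R2], [R3]), so some list satisfies all of them at once. *)
Lemma good_levelS K : good_level K -> ~ good_level K.+1 ->
  exists2 n, 0 < n & forall J, finite_SOP2 n J.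
Proof.
move=> gK /existsNP [N nC].
have N_gt0 : 0 < N.
  rewrite lt0n; apply/eqP => N0; apply: nC; rewrite N0.
  have [gP _] := prime_levels K.+1 (prime_chain 0) [::].
  apply: filterS (levels_size 0 K.+1 [::]) => l.
  by rewrite mul0n => /size0nil ->; apply: (C_branch (u := [::])).
(* Primeness turns the failure of [C] into genericity of its complement. The extra split is moved
   innermost, above each of the [2 ^ K] leaves, where two incomparable blocks produce it. *)
have nC' : iter K (@split_at word) (split_at (chain N)) [::] (~` C).
  have [_ /(_ C)] := prime_levels K.+1 (prime_chain N) [::].
  by rewrite -iterSr; case.
exists (N * 2 ^ K); first by rewrite muln_gt0 N_gt0 expn_gt0.
move=> J; pose t := split_levels K (block_tree N J [::]).
pose R := run (fun a w => [:: (a, w)]) t [::].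
pose sel (P : pred word) (l : seq (option word * word)) :=
  [seq x.2 | x <- l & oapp P false x.1].
have [RP _] : prime_filter R by exact: prime_run.
have selE P k : R (fun l => k (sel P l)) =
    iter K (@split_at word) (run_labels P (block_tree N J [::])) [::] k.
  by rewrite -run_split_levels /run_labels run_pick_label.
have R1 : R (fun l => forall u, size u <= J -> size u < J ->
    size (sel (pred1 u) l) = N * 2 ^ K).
  apply: filter_all_words => u _; have [uJ|uJ] := ltnP (size u) J; last first.
    by apply: filterE.
  have : R (fun l => size (sel (pred1 u) l) = N * 2 ^ K).
    rewrite (selE _ (fun l => size l = N * 2 ^ K)).
    by rewrite (run_block_tree1 N_gt0 uJ) //; exact: levels_size.
  exact: filterS.
have R2 : R (fun l => forall u, size u <= J -> size u = J ->
    C (sel (fun v => prefix v u) l)).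
  apply: filter_all_words => u _; have [uJ|/eqP uJ] := eqVneq (size u) J; last first.
    by apply: filterE.
  have : R (fun l => C (sel (fun v => prefix v u) l)).
    by rewrite selE (run_block_tree_branch _ uJ) //; exact: gK.
  exact: filterS.
have R3 : R (fun l => forall u1, size u1 <= J -> forall u2, size u2 <= J ->
    size u1 < J -> size u2 < J -> incomparable u1 u2 ->
    ~ C (sel (fun v => (v == u1) || (v == u2)) l)).
  apply: filter_all_words => u1 _; apply: filter_all_words => u2 _.
  have [[u1J u2J inc]|h] := EM [/\ size u1 < J, size u2 < J & incomparable u1 u2]; last first.
    by apply: filterE => l u1J u2J inc; case: h.
  have : R (fun l => ~ C (sel (fun v => (v == u1) || (v == u2)) l)).
    by rewrite (selE _ (~` C)) (run_block_tree2 N_gt0 u1J u2J inc).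
  exact: filterS.
have RI : setI_closed R by move=> A B; exact: filterI.
have /filter_ex [l [R1l [R2l R3l]]] := RI _ _ R1 (RI _ _ R2 R3).
have mem_sel (P : pred word) w v : P v -> w \in sel (pred1 v) l -> w \in sel P l.
  move=> Pv /mapP [[[v'|] w'] /=]; rewrite mem_filter //= => /andP[/eqP -> h] ->.
  by apply/mapP; exists (Some v, w') => //; rewrite mem_filter h andbT.
exists (fun u => sel (pred1 u) l); split.
- by move=> u uJ; apply: R1l => //; exact: ltnW.
- move=> u s uJ sC; apply: C_sub (R2l u _ uJ); last by rewrite uJ.
  by move=> w /sC [v vu]; exact: mem_sel.
- move=> u1 u2 u1J u2J inc Cu; apply: (R3l u1 (ltnW u1J) u2 (ltnW u2J)) => //.
  apply: C_sub Cu => w /mapP [[[v|] w'] /=]; rewrite mem_filter //=.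
  move=> /andP[vu h] ->; rewrite mem_cat; case/orP: vu => /eqP <-; apply/orP.
    by left; apply/mapP; exists (Some v, w') => //; rewrite mem_filter /= eqxx.
  by right; apply/mapP; exists (Some v, w') => //; rewrite mem_filter /= eqxx.
Qed.

Lemma good_antichain_tree K :
  (forall A, U A -> exists x m m', [/\ m < m', A (comb x m) & A (comb x m')]) ->
  good_level K -> exists h : word -> word,
    (forall u v, size u <= K -> size v <= K -> prefix u v -> u <> v ->
      sop1_conflict (h u) (h v)) /\
    (forall X : word -> Prop, (forall u, X u -> size u <= K) ->
      (forall u v, X u -> X v -> u <> v -> incomparable u v) ->
      forall s, (forall u, u \in s -> X u) -> C (map h s)).
Proof.
move=> U_comb gK.
have [|h [_ hc hC]] := @generic_antichain_tree U_comb K [::] (fun _ => C).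
  by move=> A AK; exact: run_cut_levels AK C_sub (gK 1).
exists h; split=> // X XK Xinc s sX.
have [A AK XA] := antichain_sub_cut XK Xinc.
apply: C_sub (hC A AK) => w /mapP [u us ->].
by apply: map_f; apply: XA; exact: sX.
Qed.

End Consistency.
End GenericTrees.

(** * Compactness in saturated structures *)

Lemma In_mem (T : eqType) (x : T) (s : seq T) : List.In x s <-> x \in s.
Proof.
elim: s => //= y s IH; rewrite inE; split=> [[->|/IH ->]|]; rewrite ?eqxx ?orbT //.
by case/orP => [/eqP ->|/IH]; [left|right].
Qed.

Lemma In_map (S : eqType) (T : Type) (f : S -> T) (y : T) (s : seq S) :
  List.In y (map f s) <-> exists2 x, x \in s & y = f x.
Proof.
elim: s => [|x s IH] /=; first by split=> // -[].
split=> [[<-|/IH [z zs ->]]|[z + yz]].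
- by exists x; rewrite ?mem_head.
- by exists z; rewrite // inE zs orbT.
- rewrite inE => /orP[/eqP zx|zs]; first by left; rewrite yz zx.
  by right; apply/IH; exists z.
Qed.

Section Compactness.
Variables (L : signature) (M : structure L).
Implicit Types (t : term L) (p q : formula L) (e d : nat -> dom M).

Fixpoint trename (r : nat -> nat) t : term L :=
  match t with
  | tvar i => tvar L (r i)
  | tapp f args => tapp (fun i => trename r (args i))
  end.

Fixpoint frename (r : nat -> nat) p : formula L :=
  match p with
  | ffalse => ffalse L
  | feq t1 t2 => feq (trename r t1) (trename r t2)
  | Defs.frel R args => Defs.frel (fun i => trename r (args i))
  | fimp p1 p2 => fimp (frename r p1) (frename r p2)
  | fall v p1 => fall (r v) (frename r p1)
  end.

Lemma teval_trename r e t : teval e (trename r t) = teval (e \o r) t.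
Proof.
elim: t => [//|f args IH] /=; congr fint; apply: funext => i; exact: IH.
Qed.

(* Bound variables are renamed too, so injectivity of [r] prevents capture. *)
Lemma sat_frename r e p : injective r -> sat e (frename r p) <-> sat (e \o r) p.
Proof.
move=> r_inj; elim: p e => [|t1 t2|R args|p1 IH1 p2 IH2|v p IH] e //=.
- by rewrite !teval_trename.
- rewrite (_ : (fun i => _) = fun i => teval (e \o r) (args i)) //.
  by apply: funext => i; rewrite teval_trename.
- by rewrite IH1 IH2.
- have E a : upd e (r v) a \o r = upd (e \o r) v a.
    by apply: funext => i; rewrite /upd /= (inj_eq r_inj).
  by split=> h a; move: (h a); rewrite IH E.
Qed.

Lemma teval_agree e d t : (forall v, term_has_var t v -> e v = d v) ->
  teval e t = teval d t.
Proof.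
elim: t => [v|f args IH] h /=; first exact: h.
by congr fint; apply: funext => i; apply: IH => v vi; apply: h; exists i.
Qed.

Lemma sat_agree e d p : (forall v, free p v -> e v = d v) -> sat e p <-> sat d p.
Proof.
elim: p e d => [|t1 t2|R args|p1 IH1 p2 IH2|v p IH] e d h //=.
- have E t : (forall v, term_has_var t v -> free (feq t1 t2) v) ->
      teval e t = teval d t.
    by move=> ht; apply: teval_agree => v /ht; exact: h.
  by rewrite !E // => v; [right|left].
- rewrite (_ : (fun i => _) = fun i => teval d (args i)) //.
  by apply: funext => i; apply: teval_agree => v vi; apply: h; exists i.
- have E1 : sat e p1 <-> sat d p1 by apply: IH1 => v hv; apply: h; left.
  have E2 : sat e p2 <-> sat d p2 by apply: IH2 => v hv; apply: h; right.
  by rewrite E1 E2.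
- have E a : sat (upd e v a) p <-> sat (upd d v a) p.
    apply: IH => w hw; rewrite /upd; case: eqP => // wv; exact: h.
  by split=> h' a; apply/E.
Qed.

Lemma term_bounded t : exists b, forall v, term_has_var t v -> v < b.
Proof.
elim: t => [i|f args /choice [b hb]]; first by exists i.+1 => v ->.
exists (\max_i b i) => v [i /hb vi]; apply: leq_trans vi _.
exact: (@leq_bigmax _ b i).
Qed.

Lemma formula_bounded p : exists b, forall v, free p v -> v < b.
Proof.
elim: p => [|t1 t2|R args|p1 [b1 h1] p2 [b2 h2]|v p [b h]].
- by exists 0.
- have [b1 h1] := term_bounded t1; have [b2 h2] := term_bounded t2.
  exists (maxn b1 b2) => v [/h1|/h2] hv; rewrite leq_max hv //.
  exact: orbT.
- have /choice [b hb] := fun i => term_bounded (args i).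
  exists (\max_i b i) => v [i /hb vi]; apply: leq_trans vi _.
  exact: (@leq_bigmax _ b i).
- exists (maxn b1 b2) => v [/h1|/h2] hv; rewrite leq_max hv //.
  exact: orbT.
- by exists b => w [_ /h].
Qed.

Definition fneg p := fimp p (ffalse L).
Definition fand p q := fneg (fimp p (fneg q)).
Definition fconj (ps : seq (formula L)) := foldr fand (fneg (ffalse L)) ps.
Definition fex v p := fneg (fall v (fneg p)).
Definition fexs vs p := foldr fex p vs.

Lemma sat_fconj e ps : sat e (fconj ps) <-> forall p, List.In p ps -> sat e p.
Proof.
elim: ps => [|p ps IH] /=; first by split.
split=> [h|h h'].
  have [hp hps] : sat e p /\ sat e (fconj ps).
    by apply: contrapT => n; apply: h => hp hps; apply: n.
  by move=> q [<- //|]; exact: (iffLR IH hps).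
by apply: h'; [apply: h; left|apply/IH => q hq; apply: h; right].
Qed.

Lemma sat_fexs e vs p : sat e (fexs vs p) <->
  exists d, (forall v, v \notin vs -> d v = e v) /\ sat d p.
Proof.
elim: vs e => [|v vs IH] e /=.
  split=> [h|[d [de]]]; first by exists e.
  by rewrite (_ : d = e) //; apply: funext => v; exact: de.
split.
  move=> h; have [a /IH [d [de dp]]] : exists a, sat (upd e v a) (fexs vs p).
    by apply: contrapT => n; apply: h => a ha; apply: n; exists a.
  exists d; split=> // w; rewrite inE negb_or => /andP[wv /de ->].
  by rewrite /upd (negbTE wv).
move=> [d [de dp]] /(_ (d v)); apply; apply/IH; exists d; split=> // w wvs.
rewrite /upd; case: eqVneq => [->//|wv]; apply: de.
by rewrite inE negb_or wv.
Qed.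

Lemma formulas_bounded (ps : seq (formula L)) :
  exists b, forall p, List.In p ps -> forall v, free p v -> v < b.
Proof.
elim: ps => [|p ps [b hb]]; first by exists 0.
have [b' hb'] := formula_bounded p; exists (maxn b b') => q [<-|qps] v hv.
  by rewrite leq_max (hb' _ hv) orbT.
by rewrite leq_max (hb _ qps _ hv).
Qed.

Definition finitely_satisfiable_from (Gamma : formula L -> Prop) n d :=
  forall ps, (forall p, List.In p ps -> Gamma p) ->
    exists e, (forall v, v < n -> e v = d v) /\ forall p, List.In p ps -> sat e p.

Definition swap0 (n v : nat) := if v == 0 then n else if v == n then 0 else v.

Lemma swap0K n : involutive (swap0 n).
Proof.
move=> v; rewrite /swap0; case: (eqVneq v 0) => [->|v0].
  by rewrite eqxx; case: eqP.
by case: (eqVneq v n) => [->|vn]; rewrite ?eqxx ?(negbTE v0) ?(negbTE vn).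
Qed.

Hypothesis Hsat : omega1_saturated M.

(* Saturation realizes types in the variables [x_0 .. x_{k-1}] only, hence the
   renaming by [swap0 n], which turns the n-th variable into [x_0]. *)
Lemma finitely_satisfiable_step Gamma n d :
  finitely_satisfiable_from Gamma n d ->
  exists a, finitely_satisfiable_from Gamma n.+1 (upd d n a).
Proof.
move=> fs; have /choice [bd hbd] := formulas_bounded.
pose I := {ps | forall p, List.In p ps -> Gamma p}.
(* The later variables occurring in the finite set are quantified away, which leaves a type in the
   [n]-th variable alone. *)
pose ext (j : I) := fexs (iota n.+1 (bd (sval j))) (fconj (sval j)).
pose psi j := frename (swap0 n) (ext j).
pose par (j : I) v := d (swap0 n v).
have satE j a : sat (env 1 a (par j)) (psi j) <-> sat (upd d n (a 0)) (ext j).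
  rewrite sat_frename; last exact: inv_inj (swap0K n).
  rewrite (_ : _ \o _ = upd d n (a 0)) //; apply: funext => v.
  rewrite /= /env /par /upd swap0K /swap0.
  by case: (v) (n) => [|v'] [|n'] //=; case: eqP.
have [j v|js|a ha] := @Hsat I 1 psi par d.
- by exists (swap0 n v).
- have [e [ed ejs]] : exists e, (forall v, v < n -> e v = d v) /\
      forall j p, List.In j js -> List.In p (sval j) -> sat e p.
    have [p|e [ed hjs]] := fs (flatten [seq sval j | j <- js]).
      elim: js => //= j js IH; rewrite List.in_app_iff => -[|/IH//].
      exact: (svalP j).
    exists e; split=> // j p jjs pj; apply: hjs.
    elim: js jjs => //= i js IH; rewrite List.in_app_iff => -[->|/IH]; by [left|right].
  exists (fun _ => e n) => j jjs; apply/satE; apply/sat_fexs.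
  exists (fun v => if v < n.+1 + bd (sval j) then e v else d v); split.
    move=> v; rewrite mem_iota /upd; case: (ltngtP v n) => [vn|vn|->] /=.
    - by rewrite (ltn_trans vn) ?ed // ltnS leq_addr.
    - by move=> /negbTE ->.
    - by rewrite ltnS leq_addr.
  apply/sat_fconj => p pj; apply/(@sat_agree _ e); last exact: ejs pj.
  by move=> v /(hbd _ _ pj) vb; rewrite (leq_trans vb) // leq_addl.
- exists (a 0) => ps psG; have /satE /sat_fexs := ha (exist _ ps psG).
  move=> [e [ed /sat_fconj eps]]; exists e; split=> // v vn; apply: ed.
  by rewrite mem_iota ltnNge -ltnS vn.
Qed.

(** Variables are given values one at a time, preserving finite satisfiability; each formula is
    settled once the variables below its bound have values. *)
Lemma countable_compactness (Gamma : formula L -> Prop) (d0 : dom M) :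
  (forall ps, (forall p, List.In p ps -> Gamma p) ->
    exists e, forall p, List.In p ps -> sat e p) ->
  exists e, forall p, Gamma p -> sat e p.
Proof.
move=> fs.
have /choice [f hf] : forall nd : nat * (nat -> dom M), exists a,
    finitely_satisfiable_from Gamma nd.1 nd.2 ->
    finitely_satisfiable_from Gamma nd.1.+1 (upd nd.2 nd.1 a).
  move=> [n d]; have [/finitely_satisfiable_step [a ha]|nfs] :=
    EM (finitely_satisfiable_from Gamma n d); first by exists a.
  by exists d0.
pose fix D n := if n is n'.+1 then upd (D n') n' (f (n', D n')) else fun _ => d0.
have fsD n : finitely_satisfiable_from Gamma n (D n).
  elim: n => [|n IH]; last exact: (hf (n, D n)).
  by move=> ps /fs [e he]; exists e.
have DE n v : v < n -> D n v = D v.+1 v.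
  elim: n => // n IH; rewrite ltnS leq_eqVlt => /orP[/eqP -> //|vn].
  by rewrite -IH //= /upd (ltn_eqF vn).
exists (fun v => D v.+1 v) => p Gp; have [b hb] := formula_bounded p.
have [q|e [ed ep]] := fsD b [:: p]; first by case=> // <-.
apply/(@sat_agree _ e); last by apply: ep; left.
by move=> v /hb vb; rewrite ed // DE.
Qed.

Variables (k l : nat) (phi : formula L).
Hypothesis Hfv : forall v, free phi v -> v < k + l.

Lemma inst_agree (x b b' : nat -> dom M) : (forall j, j < l -> b j = b' j) ->
  inst phi k x b <-> inst phi k x b'.
Proof.
move=> bb'; apply: sat_agree => v /Hfv vkl; case: ltnP => // kv.
by apply: bb'; rewrite ltn_subLR.
Qed.

Definition jointly_sat (I : eqType) (b : I -> nat -> dom M) (s : seq I) :=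
  exists x, forall i, i \in s -> inst phi k x (b i).

(** Joint satisfiability of finitely many instances is a single formula, so its negation can be
    imposed by compactness as well. The [i]-th tuple occupies the variables [i * l + j]. *)
Lemma jointly_sat_definable (s : seq nat) : exists p, forall e,
  sat e p <-> jointly_sat (fun i j => e (i * l + j)) s.
Proof.
have [B hB] : exists B, forall i, i \in s -> i * l + l <= B.
  exists (\max_(i <- s) (i * l + l)) => i si.
  exact: (@leq_bigmax_seq _ s xpredT (fun i => i * l + l) i).
(* All copies of [phi] share the [x]-variables, moved beyond every block to [B + v]. Variables from
   [k + l] on can only be bound; they also move up, to keep [r i] injective. *)
pose r i v := if v < k then B + v else
  if v < k + l then i * l + (v - k) else B + v.
have r_inj i : i \in s -> injective (r i).
  move=> /hB iB.
  have low v : k <= v < k + l -> i * l + (v - k) < B.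
    move=> /andP[kv vl]; apply: leq_trans iB.
    by rewrite ltn_add2l ltn_subLR.
  have rE v : r i v = if k <= v < k + l then i * l + (v - k) else B + v.
    by rewrite /r; case: ltnP => //= _.
  move=> v w; rewrite !rE; case: ifPn => [hv|_]; case: ifPn => [hw|_].
  - move=> /addnI; move: hv hw => /andP[kv _] /andP[kw _] h.
    by rewrite -(subnKC kv) h subnKC.
  - by move=> h; move: (low _ hv); rewrite h ltnNge leq_addr.
  - by move=> h; move: (low _ hw); rewrite -h ltnNge leq_addr.
  - exact: addnI.
exists (fexs (iota B k) (fconj [seq frename (r i) phi | i <- s])) => e.
have E d i : i \in s -> (forall v, v \notin iota B k -> d v = e v) ->
    sat d (frename (r i) phi) <->
    inst phi k (fun j => d (B + j)) (fun j => e (i * l + j)).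
  move=> si de; rewrite sat_frename; last exact: r_inj.
  apply: sat_agree => v /Hfv vkl; rewrite /= /r vkl; case: ltnP => // kv.
  apply: de; rewrite mem_iota negb_and -ltnNge (leq_trans _ (hB _ si)) //.
  by rewrite ltn_add2l ltn_subLR.
rewrite sat_fexs; split.
  move=> [d [de /sat_fconj ds]]; exists (fun j => d (B + j)) => i si.
  by apply/E => //; apply: ds; apply/In_map; exists i.
move=> [x hx].
pose d v := if B <= v < B + k then x (v - B) else e v.
have de v : v \notin iota B k -> d v = e v.
  by rewrite mem_iota /d => /negbTE ->.
exists d; split=> //; apply/sat_fconj => _ /In_map [i si ->].
apply/E => //; move: (hx i si); apply: (iffLR _).
apply: sat_agree => v _; case: ltnP => // vk.
by rewrite /d leq_addr ltn_add2l vk addKn.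
Qed.

(** The unknown family is coded by one assignment, with [b i] in block [pickle i]. Monotonicity in
    [J] places any finite set of constraints in one stage. *)
Lemma inst_compactness (d0 : dom M) (I : countType) (pos neg : nat -> seq I -> Prop) :
  (forall J J' s, J <= J' -> pos J s -> pos J' s) ->
  (forall J J' s, J <= J' -> neg J s -> neg J' s) ->
  (forall J, exists b : I -> nat -> dom M,
    (forall s, pos J s -> jointly_sat b s) /\
    (forall s, neg J s -> ~ jointly_sat b s)) ->
  exists b : I -> nat -> dom M,
    (forall J s, pos J s -> jointly_sat b s) /\
    (forall J s, neg J s -> ~ jointly_sat b s).
Proof.
move=> posS negS fin; have /choice [F hF] := jointly_sat_definable.
pose G J p := (exists2 s, pos J s & p = F (map pickle s)) \/
              (exists2 s, neg J s & p = fneg (F (map pickle s))).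
have GS J J' p : J <= J' -> G J p -> G J' p.
  move=> JJ' [[s ps ->]|[s ns ->]]; [left|right]; exists s => //.
    exact: posS ps.
  exact: negS ns.
have FE e (b : I -> nat -> dom M) s :
    (forall i j, j < l -> e (pickle i * l + j) = b i j) ->
    sat e (F (map pickle s)) <-> jointly_sat b s.
  move=> eb; rewrite hF; split=> -[x hx]; exists x.
    move=> i si; apply: (iffLR (inst_agree _ (eb i))); apply: hx.
    exact: map_f.
  move=> _ /mapP [i si ->]; apply: (iffRL (inst_agree _ (eb i))); exact: hx.
have [ps psG|e he] := @countable_compactness (fun p => exists J, G J p) d0.
  have [J hJ] : exists J, forall p, List.In p ps -> G J p.
    elim: ps psG => [|p ps IH] psG; first by exists 0.
    have [J1 h1] := psG p (or_introl erefl).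
    have [|J2 h2] := IH; first by move=> q qps; apply: psG; right.
    exists (maxn J1 J2) => q [<-|/h2].
      by apply: GS h1; exact: leq_maxl.
    by apply: GS; exact: leq_maxr.
  have [b [bp bn]] := fin J.
  (* Division by [l] recovers block and position; [d0] fills the blocks that code no element. *)
  pose e v := if unpickle (v %/ l) is Some i then b i (v %% l) else d0.
  have eb i j : j < l -> e (pickle i * l + j) = b i j.
    move=> jl; have l0 : 0 < l by apply: leq_ltn_trans jl.
    by rewrite /e divnMDl // divn_small // addn0 pickleK modnMDl modn_small.
  exists e => p /hJ [[s ps' ->]|[s ns ->]]; first by apply/(FE e b s eb)/bp.
  by move=> /(FE e b s eb); exact: bn.
exists (fun i j => e (pickle i * l + j)); split=> J s hs.
  by apply/(FE e) => //; apply: he; exists J; left; exists s.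
move=> /(FE e) h.
have : sat e (fneg (F (map pickle s))) by apply: he; exists J; right; exists s.
by apply; exact: h.
Qed.

End Compactness.

(** * From finite configurations to infinite trees *)

Section Assembly.
Variables (L : signature) (M : structure L).
Hypothesis Hsat : omega1_saturated M.
Variables (d0 : dom M) (k l : nat) (phi : formula L).
Hypothesis Hfv : forall v, free phi v -> v < k + l.
Variable a : word -> nat -> dom M.

Lemma SOP2_of_finite n : 0 < n ->
  (forall J, finite_SOP2 (jointly_sat k phi a) n J) ->
  witnesses_SOP2 (conj_rel (@inst L M phi k) l n.-1).
Proof.
move=> n0 fin.
pose blocks (us : seq word) := [seq (u, i) | u <- us, i <- iota 0 n].
(* Only proper prefixes of [u] are used, because [finite_SOP2] controls nodes strictly below height
   [J]. *)
pose pos J (s : seq (word * nat)) := exists2 u, size u <= J &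
  forall q, q \in s -> [/\ prefix q.1 u, size q.1 < size u & q.2 < n].
pose neg J (s : seq (word * nat)) := exists u1 u2,
  [/\ size u1 < J, size u2 < J, incomparable u1 u2 & s = blocks [:: u1; u2]].
have blocksP us u i : ((u, i) \in blocks us) = (u \in us) && (i < n).
  apply/allpairsP/andP => [[[v j] /= [vus]]|[uus i_n]].
    by rewrite mem_iota => j_n [-> ->].
  by exists (u, i); rewrite mem_iota.
have [||J|b [bp bn]] := @inst_compactness L M Hsat k l phi Hfv d0 _ pos neg.
- by move=> J J' s JJ' [u uJ h]; exists u => //; exact: leq_trans JJ'.
- move=> J J' s JJ' [u1 [u2 [h1 h2 inc ->]]]; exists u1, u2.
  by split=> //; [exact: leq_trans JJ'|exact: leq_trans JJ'].
- have [c [c_size c_branch c_inc]] := fin J.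
  exists (fun q => a (nth [::] (c q.1) q.2)); split.
    (* The branch [u] is padded with zeros to the full length [J] required by [finite_SOP2]. *)
    move=> s [u uJ us]; pose u' := u ++ nseq (J - size u) false.
    have [||x hx] := c_branch u' [seq nth [::] (c q.1) q.2 | q <- s].
    - by rewrite size_cat size_nseq subnKC.
    - move=> _ /mapP [q /us [qu quJ qn] ->]; exists q.1.
        by apply: prefix_trans qu _; exact: prefix_prefix.
      by apply: mem_nth; rewrite c_size // (leq_trans quJ).
    - by exists x => q qs; apply: hx; apply/mapP; exists q.
  move=> s [u1 [u2 [u1J u2J inc ->]]] [x hx].
  apply: (c_inc u1 u2) => //; exists x => w.
  have cP u : size u < J -> u \in [:: u1; u2] -> w \in c u -> inst phi k x (a w).
    move=> uJ uin wc; rewrite -(nth_index [::] wc); apply: (hx (u, index w (c u))).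
    by rewrite blocksP uin -(c_size u uJ) index_mem.
  by rewrite mem_cat => /orP[]; apply: cP; rewrite // !inE eqxx ?orbT.
(* The [n] tuples at node [u] are concatenated into one parameter of the conjunction. *)
pose c (u : word) t := b (u, t %/ l) (t %% l).
have cE x u : conj_rel (@inst L M phi k) l n.-1 x (c u) <->
    forall i, i < n -> inst phi k x (b (u, i)).
  have E i : inst phi k x (fun j => c u (i * l + j)) <-> inst phi k x (b (u, i)).
    apply: inst_agree Hfv _ _ _ _ => j jl.
    have l0 : 0 < l by apply: leq_ltn_trans jl.
    by rewrite /c divnMDl // divn_small // addn0 modnMDl modn_small.
  have nE i : (i <= n.-1) = (i < n) by rewrite -[in RHS](prednK n0).
  by split=> h i i_n; apply/E; apply: h; rewrite ?nE // -nE.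
exists c; split.
  move=> eta js _; pose m := \max_(j <- js) j.
  have [|x hx] := bp m.+1 (blocks (map (branch eta) js)).
    exists (branch eta m.+1); first by rewrite size_mkseq.
    move=> [u i]; rewrite blocksP => /andP[/mapP [j jjs ->] i_n].
    have jm : j <= m by exact: (@leq_bigmax_seq _ js xpredT id j).
    rewrite /branch !size_mkseq ltnS; split=> //; rewrite [(_, _).1]/=.
    apply/prefixP; exists (map eta (iota j (m.+1 - j))).
    by rewrite /mkseq -map_cat -[in LHS](subnKC (leqW jm)) iotaD.
  exists x => j /In_mem jjs; apply/cE => i i_n; apply: hx.
  by rewrite blocksP i_n map_f.
move=> u1 u2 inc /(_ [:: u1; u2]) [|x hx].
  by move=> j [<-|[<-|[]]]; [left|right].
apply: (bn (maxn (size u1) (size u2)).+1 (blocks [:: u1; u2])).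
  by exists u1, u2; split; rewrite // ltnS ?leq_maxl ?leq_maxr.
exists x => -[u i]; rewrite blocksP => /andP[uin i_n].
by apply: (iffLR (cE x u)) => //; apply: hx; apply/In_mem.
Qed.

(** Consistency is finitary, and a set that is not an antichain contains a comparable pair, so
    finite antichains and comparable pairs give all constraints. *)
Lemma antichain_tree_of_finite :
  (forall K, exists h : word -> word,
    (forall u v, size u <= K -> size v <= K -> prefix u v -> u <> v ->
      ~ jointly_sat k phi a [:: h u; h v]) /\
    (forall s : seq word, (forall u, u \in s -> size u <= K) ->
      (forall u v, u \in s -> v \in s -> u <> v -> incomparable u v) ->
      jointly_sat k phi a (map h s))) ->
  exists b, antichain_tree (@inst L M phi k) b.
Proof.
move=> fin.
pose pos J (s : seq word) := (forall u, u \in s -> size u <= J) /\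
  (forall u v, u \in s -> v \in s -> u <> v -> incomparable u v).
pose neg J (s : seq word) := exists u v, [/\ size u <= J, size v <= J,
  prefix u v, u <> v & s = [:: u; v]].
have [||J|b [bp bn]] := @inst_compactness L M Hsat k l phi Hfv d0 _ pos neg.
- by move=> J J' s JJ' [sJ si]; split=> // u /sJ uJ; exact: leq_trans JJ'.
- move=> J J' s JJ' [u [v [uJ vJ uv nuv ->]]]; exists u, v.
  by split=> //; [exact: leq_trans JJ'|exact: leq_trans JJ'].
- have [h [hneg hpos]] := fin J; exists (fun u => a (h u)); split.
    move=> s [sJ si]; have [x hx] := hpos s sJ si; exists x => u us.
    by apply: hx; exact: map_f.
  move=> s [u [v [uJ vJ uv nuv ->]]] [x hx]; apply: (hneg u v uJ vJ uv nuv).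
  by exists x => w; rewrite !inE => /orP[] /eqP ->; apply: hx; rewrite !inE eqxx ?orbT.
have comparable_neg u v : prefix u v -> u <> v -> ~ jointly_sat k phi b [:: u; v].
  move=> uv nuv; apply: (bn (maxn (size u) (size v))); exists u, v.
  by split; rewrite ?leq_maxl ?leq_maxr.
exists b => X; split=> [cX u v Xu Xv nuv|Xinc js jsX].
  have [|x hx] := cX [:: u; v]; first by move=> j [<-|[<-|[]]].
  split; apply/negP => huv.
    apply: (comparable_neg u v huv nuv); exists x => i /In_mem; exact: hx.
  apply: (comparable_neg v u huv (nesym nuv)); exists x => i.
  by rewrite !inE orbC => hi; apply: hx; apply/In_mem; rewrite !inE.
have [|x hx] := bp (\max_(u <- js) size u) js.
  split=> [u us|u v /In_mem/jsX Xu /In_mem/jsX Xv]; last exact: Xinc.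
  exact: (@leq_bigmax_seq _ js xpredT size u).
by exists x => u /In_mem; exact: hx.
Qed.

End Assembly.

Theorem theorem4p8 (L : signature) (M : structure L)
  (HM : inhabited (dom M)) (Hsat : omega1_saturated M)
  (k l : nat) (phi : formula L)
  (Hfv : forall v, free phi v -> v < k + l)
  (HSOP1 : witnesses_SOP1 (@inst L M phi k))
  (HnSOP2 : forall n : nat, ~ witnesses_SOP2 (conj_rel (@inst L M phi k) l n)) :
  exists b : seq bool -> nat -> dom M, antichain_tree (@inst L M phi k) b.
Proof.
case: HM => d0; case: HSOP1 => a [a_branch a_conflict].
pose C := jointly_sat k phi a.
have C_sub s s' : {subset s <= s'} -> C s' -> C s.
  by move=> ss' [x hx]; exists x => w /ss'; exact: hx.
have C_branch u s : (forall w, w \in s -> prefix w u) -> C s.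
  (* The word [u] is continued by zeros to an infinite branch, on which a prefix of [u] is
     determined by its length. *)
  move=> su; have [//|x hx] := a_branch (nth false u) (map size s).
  exists x => w ws; have /prefixP [v uE] := su w ws.
  have -> : w = branch (nth false u) (size w).
    rewrite /branch; apply: (@eq_from_nth _ false) => [|i iw].
      by rewrite size_mkseq.
    by rewrite nth_mkseq // uE nth_cat iw.
  by apply: hx; apply/In_mem; exact: map_f.
have C_conflict u v : sop1_conflict u v -> ~ C [:: u; v].
  move=> [eta [nu [-> ->]]] [x hx]; apply: (a_conflict eta nu) => js hjs.
  exists x => j /hjs [] ->; apply: hx; rewrite !inE eqxx ?orbT //.
have [U [UU U_idem U_comb]] := exists_comb_ultrafilter.
have good K : good_level U C K.
  elim: K => [|K IH]; first exact: good_level0.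
  apply: contrapT => /(good_levelS UU U_idem C_sub C_branch IH) [n n0 fin].
  (* [conj_rel] counts its instances from 0, so [n] instances correspond to the index [n.-1]; this
     uses [0 < n]. *)
  by apply: (HnSOP2 n.-1); apply: SOP2_of_finite fin.
apply: (antichain_tree_of_finite Hsat d0 Hfv (a := a)) => K.
have [h [hc hC]] := good_antichain_tree UU U_idem C_sub U_comb (good K).
exists h; split=> [u v uK vK uv nuv|s sK sinc].
  by apply: C_conflict; exact: hc.
by apply: (hC (fun u => u \in s)).
Qed.
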